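(* Let $\lambda,\mu$ be algebraic integers of degree $p$ and $q$ over $\mathbb{Q}$ respectively, with sets of conjugates $\{\lambda=\lambda_1,\dots,\lambda_p\}$ and $\{\mu=\mu_1,\dots,\mu_q\}$, such that (1) $\lambda$ and $\mu$ are units, (2) $|\lambda_i|\neq 1$ and $|\mu_j|\neq 1$ for all $i,j$, and (3) $|\lambda_i\mu_j|\neq 1$ for all $i,j$. Let $\mathfrak{n}$ be the real Lie algebra with basis $\{X_{(i,j)}, Y_i, Z_j : 1\le i\le p,\ 1\le j\le q\}$ whose only nonzero brackets among basis elements (up to skew-symmetry) are $$[X_{(i,j)},Y_i]=Z_j,\qquad 1\le i\le p,\ 1\le j\le q.$$ Then $\mathfrak{n}$ is a two-step nilpotent Anosov Lie algebra of type $(pq+p,\,q)$.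
   Context: A real Lie algebra of dimension $n$ is called Anosov if it admits a Lie algebra automorphism $\tau$ that is hyperbolic (none of its complex eigenvalues has modulus $1$) and such that the matrix of $\tau$ lies in $\mathrm{GL}_n(\mathbb{Z})$ with respect to some $\mathbb{Z}$-basis, i.e. a basis with integer structure constants. The type of a nilpotent Lie algebra $\mathfrak{n}$ is the tuple $(n_1,\dots,n_r)$ with $n_i=\dim C^{i-1}(\mathfrak{n})/C^i(\mathfrak{n})$, where $C^0(\mathfrak{n})=\mathfrak{n}$, $C^{i}(\mathfrak{n})=[\mathfrak{n},C^{i-1}(\mathfrak{n})]$ is the descending central series, and $C^r(\mathfrak{n})=0\ne C^{r-1}(\mathfrak{n})$. *)

(* Defs.v *)
From HB Require Import structures.
From mathcomp Require Import all_boot all_order all_algebra.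
From mathcomp Require Import reals complex.

Set Implicit Arguments.
Unset Strict Implicit.
Unset Printing Implicit Defensive.

Import Order.TTheory GRing.Theory Num.Theory.
Local Open Scope ring_scope.

HB.mixin Record isLie (K : fieldType) L of Vector K L := {
  lie_bracket : L -> L -> L;
  lie_bracketPl : forall z : L, linear (fun x => lie_bracket x z);
  lie_bracketPr : forall x : L, linear (lie_bracket x);
  lie_bracketxx : forall x : L, lie_bracket x x = 0;
  lie_jacobi : forall x y z : L,
    lie_bracket x (lie_bracket y z) + lie_bracket y (lie_bracket z x)
      + lie_bracket z (lie_bracket x y) = 0
}.

#[short(type="lieAlgType")]
HB.structure Definition LieAlgebra (K : fieldType) :=
  { L of isLie K L & Vector K L }.

Section LieAlgebras.
Context {K : fieldType} {L : lieAlgType K}.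
Implicit Types U V W : {vspace L}.

(* [U, V], the span of all brackets of an element of U with an element of V;
   by bilinearity the bases are enough, see lie_bracketvP. *)
Definition lie_bracketv U V : {vspace L} :=
  <<[seq lie_bracket u v | u <- vbasis U, v <- vbasis V]>>%VS.

Lemma lie_bracketvP U V W :
  reflect (forall u v, u \in U -> v \in V -> lie_bracket u v \in W)
          (lie_bracketv U V <= W)%VS.
Proof.
apply: (iffP span_subvP) => [sW u v uU vV | sW _ /allpairsP[[u v] /= [uU vV ->]]];
  last by apply: sW; apply: vbasis_mem.
pose rb (y : L) : {linear L -> L} := HB.pack (fun x : L => lie_bracket x y)
  (GRing.isLinear.Build K L L _ (fun x => lie_bracket x y) (lie_bracketPl y)).
pose lb (x : L) : {linear L -> L} := HB.pack (fun y : L => lie_bracket x y)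
  (GRing.isLinear.Build K L L _ (fun y => lie_bracket x y) (lie_bracketPr x)).
rewrite (coord_vbasis uU) -[lie_bracket _ _]/(rb v _) linear_sum.
apply: memv_suml => i _; rewrite linearZ_LR memvZ //= (coord_vbasis vV).
rewrite -[lie_bracket _ _]/(lb _ _) linear_sum.
apply: memv_suml => j _; rewrite linearZ_LR memvZ //=.
by apply/sW/allpairsP; exists ((vbasis U)`_i, (vbasis V)`_j);
  rewrite !mem_nth ?size_tuple.
Qed.

(* C^i(L), with C^0(L) = L and C^i(L) = [L, C^(i-1)(L)]. *)
Definition lower_central (i : nat) : {vspace L} :=
  iter i (lie_bracketv fullv) fullv.

Lemma lower_central_sub i : (lower_central i.+1 <= lower_central i)%VS.
Proof.
elim: i => [|i IHi]; first exact: subvf.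
apply/lie_bracketvP => u v uL vC; move/lie_bracketvP: (subvv (lower_central i.+1)).
by apply => //; apply: (subvP IHi).
Qed.

End LieAlgebras.
Arguments lower_central {K} L i.

Definition nilpotent_of_step (K : fieldType) (L : lieAlgType K) (r : nat) :=
  lower_central L r = 0%VS /\ lower_central L r.-1 <> 0%VS.

(* s = (n_1, ..., n_r), stored from index 0.  The truncated difference below is
   the dimension of C^i(L) / C^(i+1)(L), by lower_central_sub. *)
Definition has_type (K : fieldType) (L : lieAlgType K) (s : seq nat) :=
  nilpotent_of_step L (size s) /\
  forall i, (i < size s)%N ->
    nth 0%N s i = (\dim (lower_central L i) - \dim (lower_central L i.+1))%N.

Definition lie_automorphism (K : fieldType) (L : lieAlgType K) (t : 'End(L)) :=
  bijective t /\
  forall x y : L, t (lie_bracket x y) = lie_bracket (t x) (t y).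

Section Anosov.
Context {R : realType} {L : lieAlgType R}.

(* The complex eigenvalues of t are those of its matrix in some (here, the
   canonical) basis of L, seen as a complex matrix. *)
Definition hyperbolic (t : 'End(L)) :=
  forall z : R[i],
    eigenvalue
      (map_mx (real_complex R) (passmx.mxof (vbasis {:L}) (vbasis {:L}) t)) z ->
    `|z| != 1.

Definition Zbasis (e : (\dim {:L}).-tuple L) :=
  basis_of {:L} e /\
  forall i j k : 'I_(\dim {:L}),
    coord e k (lie_bracket e`_i e`_j) \is a Num.int.

(* mxof acts on row vectors of coordinates: it is the transpose of the usual
   matrix of t, which does not affect membership in GL_n(Z). *)
Definition matrix_in_GLZ (e : (\dim {:L}).-tuple L) (t : 'End(L)) :=
  exists2 M : 'M[int]_(\dim {:L}),
    M \in unitmx & passmx.mxof e e t = map_mx intr M.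

End Anosov.

Definition Anosov (R : realType) (L : lieAlgType R) :=
  exists t : 'End(L), [/\ lie_automorphism t, hyperbolic t &
    exists2 e : (\dim {:L}).-tuple L, Zbasis e & matrix_in_GLZ e t].

Section AlgebraicNumbers.
Context {C : numFieldType}.
Implicit Types x y : C.

Definition algebraic_integer x := integralOver (intr : int -> C) x.

Definition algebraic_integer_unit x :=
  algebraic_integer x /\ exists2 y, algebraic_integer y & x * y = 1.

Definition minimal_poly x (P : {poly rat}) :=
  [/\ P \is monic, irreducible_poly P & root (map_poly ratr P) x].

Definition has_degree x (d : nat) :=
  exists2 P : {poly rat}, minimal_poly x P & size P = d.+1.

Definition conjugate x y :=
  exists2 P : {poly rat}, minimal_poly x P & root (map_poly ratr P) y.

(* x = s_1, ..., s_d are the conjugates of x (indices start at 0).  They are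
   pairwise distinct when d is the degree of x. *)
Definition conjugates x d (s : 'I_d -> C) :=
  (forall i : 'I_d, i = 0%N :> nat -> s i = x) /\
  (forall y, conjugate x y <-> exists i, s i = y).

End AlgebraicNumbers.

(* The brackets not listed follow by skew-symmetry. *)
Record standard_basis (K : fieldType) (L : lieAlgType K) (p q : nat)
    (X : 'I_p -> 'I_q -> L) (Y : 'I_p -> L) (Z : 'I_q -> L) : Prop := {
  standard_basisP : basis_of {:L}
    ([seq X i j | i <- enum 'I_p, j <- enum 'I_q]
       ++ [seq Y i | i <- enum 'I_p] ++ [seq Z j | j <- enum 'I_q]);
  bracketXY : forall i j k,
    lie_bracket (X i j) (Y k) = if i == k then Z j else 0;
  bracketXX : forall i j k l, lie_bracket (X i j) (X k l) = 0;
  bracketXZ : forall i j l, lie_bracket (X i j) (Z l) = 0;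
  bracketYY : forall i k, lie_bracket (Y i) (Y k) = 0;
  bracketYZ : forall i l, lie_bracket (Y i) (Z l) = 0;
  bracketZZ : forall j l, lie_bracket (Z j) (Z l) = 0
}.

(* Such a Lie algebra exists for all p and q. *)
Section StandardModel.
Context (K : fieldType) (p q : nat).

Definition standard_carrier : Type := 'M[K]_(p, q) * ('rV[K]_p * 'rV[K]_q).
HB.instance Definition _ := Vector.copy standard_carrier
  ('M[K]_(p, q) * ('rV[K]_p * 'rV[K]_q))%type.
Implicit Types x y z : standard_carrier.

Definition standard_bracket x y : standard_carrier :=
  (0, (0, y.2.1 *m x.1 - x.2.1 *m y.1)).

Lemma standard_bracketPl z : linear (fun x => standard_bracket x z).
Proof.
move=> a x y; rewrite /standard_bracket; congr (_, (_, _)) => /=;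
  rewrite ?scaler0 ?addr0 //.
by rewrite mulmxDr mulmxDl -scalemxAr -scalemxAl scalerBr opprD addrACA.
Qed.

Lemma standard_bracketPr x : linear (standard_bracket x).
Proof.
move=> a y z; rewrite /standard_bracket; congr (_, (_, _)) => /=;
  rewrite ?scaler0 ?addr0 //.
by rewrite mulmxDr mulmxDl -scalemxAr -scalemxAl scalerBr opprD addrACA.
Qed.

Lemma standard_bracketxx x : standard_bracket x x = 0.
Proof. by rewrite /standard_bracket subrr. Qed.

Lemma standard_jacobi x y z :
  standard_bracket x (standard_bracket y z)
    + standard_bracket y (standard_bracket z x)
    + standard_bracket z (standard_bracket x y) = 0.
Proof.
rewrite /standard_bracket /= !(mul0mx, mulmx0) !subrr.
exact: etrans (addr0 _) (addr0 _).
Qed.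

HB.instance Definition _ := isLie.Build K standard_carrier
  standard_bracketPl standard_bracketPr standard_bracketxx standard_jacobi.

Lemma standard_basis_exists :
  exists (L : lieAlgType K) (X : 'I_p -> 'I_q -> L) Y Z, standard_basis X Y Z.
Proof.
pose X i j : standard_carrier := (delta_mx i j, 0).
pose Y i : standard_carrier := (0, (delta_mx 0 i, 0)).
pose Z j : standard_carrier := (0, (0, delta_mx 0 j)).
exists standard_carrier, X, Y, Z; split.
- rewrite basisEdim; apply/andP; split; last first.
    have eI m : size (Finite.enum (ordinal m)) = m by rewrite -enumT size_enum_ord.
    rewrite !size_cat size_allpairs !size_map !eI dimvf.
    by rewrite -[leqRHS]/(p * q + (1 * p + 1 * q))%N !mul1n.
  apply/subvP => -[A [y z]] _.
  have -> : (A, (y, z)) = \sum_i \sum_j A i j *: X i j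
     + (\sum_i y 0 i *: Y i + \sum_j z 0 j *: Z j) :> standard_carrier.
    have inX : {morph (fun B => (B, 0) : standard_carrier) : B C / B + C}.
      by move=> B C; congr (_, _); rewrite addr0.
    have inY : {morph (fun v => (0, (v, 0)) : standard_carrier) : v w / v + w}.
      by move=> v w; congr (_, (_, _)); rewrite addr0.
    have inZ : {morph (fun v => (0, (0, v)) : standard_carrier) : v w / v + w}.
      by move=> v w; congr (_, (_, _)); rewrite addr0.
    have -> : (A, (y, z)) = (A, 0) + ((0, (y, 0)) + (0, (0, z)))
        :> standard_carrier.
      by do 2?apply: f_equal2; rewrite /= ?addr0 ?add0r.
    rewrite {1}(matrix_sum_delta A) {1}(row_sum_delta y) {1}(row_sum_delta z).
    rewrite (big_morph _ inX (erefl _)) (big_morph _ inY (erefl _)).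
    rewrite (big_morph _ inZ (erefl _)); congr (_ + (_ + _)).
    + apply: eq_bigr => i _; rewrite (big_morph _ inX (erefl _)).
      by apply: eq_bigr => j _; congr (_, _); rewrite scaler0.
    + by apply: eq_bigr => i _; congr (_, (_, _)); rewrite scaler0.
    + by apply: eq_bigr => j _; congr (_, (_, _)); rewrite scaler0.
  rewrite !span_cat !memv_add //.
  + apply: memv_suml => i _; apply: memv_suml => j _; apply/memvZ/memv_span.
    by apply/allpairsP; exists (i, j); rewrite !mem_enum.
  + apply: memv_suml => i _; apply/memvZ/memv_span.
    by apply: map_f; rewrite mem_enum.
  + apply: memv_suml => j _; apply/memvZ/memv_span.
    by apply: map_f; rewrite mem_enum.
all: rewrite /lie_bracket /= /standard_bracket /= => *.
- by rewrite mulmx0 subr0 mul_delta_mx_cond eq_sym; case: eqP.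
all: by rewrite ?mulmx0 ?mul0mx subrr.
Qed.
End StandardModel.

(* Main.v *)
Require Import Defs.
From HB Require Import structures.
From mathcomp Require Import all_boot all_order all_algebra.
From mathcomp Require Import reals complex.

(** In matrix form the bracket of [n] is the product [y *m A] of a row vector and a
    [p x q] matrix, so for [S] in [GL_p(Z)] and [T] in [GL_q(Z)] the map
    [A |-> S A T], [y |-> y S^-1], [z |-> z T] is an automorphism, and it is
    integral in the standard basis.  Take for [S] and [T] the companion matrices
    of the minimal polynomials of [lambda] and [mu], which have integer
    coefficients and constant term a unit.  The eigenvalues of the map are then
    among the [lambda_i mu_j], [lambda_i^-1] and [mu_j]. *)

Set Implicit Arguments.
Unset Strict Implicit.
Unset Printing Implicit Defensive.

Import Order.TTheory GRing.Theory Num.Theory passmx.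
Local Open Scope ring_scope.

(** * Minimal polynomials of algebraic units *)

Section MinimalPolynomial.
Context {C : numFieldType}.
Implicit Types (x : C) (P : {poly rat}).

(** The gcd of [P] and [Q] divides the irreducible [P], so it is constant or associate to [P]. A
    constant gcd would stay constant over [C], where [x] is a common root. *)
Lemma minimal_poly_dvdp x P (Q : {poly rat}) :
  minimal_poly x P -> root (map_poly ratr Q) x -> P %| Q.
Proof.
move=> [_ Pirr Px] Qx; have [coPQ|eqP] := irredp_XsubCP Pirr (dvdp_gcdl P Q).
  have := @coprimep_map _ C ratr P Q.
  rewrite /coprimep (eqp_size coPQ) size_poly1 eqxx => /coprimep_root /(_ Px).
  by rewrite -[_ == 0]/(root _ _) Qx.
by rewrite -(eqp_dvdl _ eqP) dvdp_gcdr.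
Qed.

Lemma map_poly_ratr_intr (Q : {poly int}) :
  map_poly (ratr : rat -> C) (map_poly intr Q) = map_poly intr Q.
Proof.
by rewrite -map_poly_comp; apply: eq_map_poly => z /=; rewrite ratr_int.
Qed.

(** The reversed polynomial takes at [x] the value of [Q] at [x^-1] times [x ^+ (size Q).-1]. *)
Lemma root_inv_revpoly x (Q : {poly C}) : x != 0 -> root Q x^-1 ->
  root (\poly_(i < size Q) Q`_((size Q).-1 - i)) x.
Proof.
move=> x0 /eqP Qx; apply/eqP; rewrite horner_poly.
have [->|Q0] := eqVneq Q 0; first by rewrite size_poly0 big_ord0.
have sQ : size Q = (size Q).-1.+1 by rewrite polySpred.
move: Qx; rewrite horner_coef => /(congr1 ( *%R (x ^+ (size Q).-1))).
rewrite mulr0 mulr_sumr (reindex_inj rev_ord_inj) /=; apply: etrans.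
apply: eq_bigr => i _; have ->: (size Q - i.+1 = (size Q).-1 - i)%N.
  by rewrite {1}sQ subSS.
have le_i : (i <= (size Q).-1)%N by rewrite -ltnS -sQ.
by rewrite mulrCA exprVn -[in X in _ * (X / _)](subnKC le_i) exprD mulfK
  ?expf_neq0.
Qed.

(** Gauss's lemma makes [P] integral. The inverse of [x] is a root of a monic integer polynomial,
    whose reversal vanishes at [x] and has constant coefficient 1; hence the constant coefficient of
    [P1] divides 1. *)
Lemma minimal_poly_unit x P : minimal_poly x P -> algebraic_integer_unit x ->
  exists P1 : {poly int},
    [/\ P1 \is monic, P = map_poly intr P1 & P1`_0 \is a GRing.unit].
Proof.
move=> Pmin [[Q Qmon Qx] [y [Q' Q'mon Q'y] xy1]].
have [Pmon _ _] := Pmin.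
have [P1 [P1mon PE]] :
    exists P1 : {poly int}, P1 \is monic /\ P = map_poly intr P1.
  have: P %| map_poly intr Q.
    by apply: (minimal_poly_dvdp Pmin); rewrite map_poly_ratr_intr.
  move=> /dvdpP_rat_int[P1 [a a0 PE] [r QE]].
  (* The leading coefficient [l] of an integer factor of the monic [Q] divides 1, so it is 1 or
     -1. *)
  move: Qmon; rewrite monicE QE lead_coefM => /eqP lead1.
  set l := lead_coef P1 in lead1.
  have l2 : l * l = 1.
    have : l \is a GRing.unit.
      by apply/unitrP; exists (lead_coef r); rewrite mulrC lead1.
    by case/orP => /eqP ->.
  exists (l *: P1); split; first by rewrite monicE lead_coefZ l2.
  (* As [P] is monic, [a] times [l] is 1, and so is [l * l]. *)
  have aE : a = l%:~R.
    move: Pmon; rewrite monicE PE lead_coefZ lead_coef_map_inj //;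
      last exact: intr_inj.
    rewrite -/l => /eqP al; apply: (mulIf (_ : l%:~R != 0)).
      by apply: contra_eq_neq al => ->; rewrite mulr0 eq_sym oner_eq0.
    by rewrite al -intrM l2.
  by rewrite map_polyZ PE aE.
exists P1; split => //.
have x0 : x != 0 by apply: contra_eq_neq xy1 => ->; rewrite mul0r eq_sym oner_eq0.
have yE : y = x^-1 by rewrite -[y](mulKf x0) xy1 mulr1.
rewrite yE in Q'y; have := root_inv_revpoly x0 Q'y.
pose Q2 := \poly_(i < size Q') Q'`_((size Q').-1 - i).
have -> : \poly_(i < size (map_poly (intr : int -> C) Q'))
    (map_poly intr Q')`_((size (map_poly (intr : int -> C) Q')).-1 - i)
    = map_poly intr Q2 :> {poly C}.
  have -> : size (map_poly (intr : int -> C) Q') = size Q'.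
    by apply: size_map_inj_poly => //; apply: intr_inj.
  apply/polyP => i; rewrite [in RHS]coef_map_id0 // coef_poly [in RHS]coef_poly.
  by case: ltnP => // lt_i; rewrite coef_map_id0.
rewrite -map_poly_ratr_intr => /(minimal_poly_dvdp Pmin).
(* Since [P1] is monic, divisibility over the rationals yields a quotient [r] with integer
   coefficients. *)
rewrite PE dvdp_rat_int => /(Pdiv.IdomainMonic.dvdpP P1mon)[r Q2E].
have: Q2`_0 = 1.
  rewrite coef_poly subn0 size_poly_gt0 monic_neq0 // -lead_coefE.
  exact: (monicP Q'mon).
by rewrite Q2E coef0M => rP; apply/unitrP; exists r`_0; split; rewrite ?rP // mulrC rP.
Qed.
End MinimalPolynomial.

(** Up to sign, the determinant is the constant coefficient of the characteristic polynomial. *)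
Lemma unit_char_poly_matrix (p : nat) (P : {poly int}) :
  P \is monic -> size P = p.+1 -> P`_0 \is a GRing.unit ->
  exists2 S : 'M[int]_p, S \in unitmx & char_poly S = P.
Proof.
move=> Pmon sP P0; have -> : p = (size P).-1 by rewrite sP.
exists (companionmx P); last exact: companionmxK.
by move: P0; rewrite -{1}(companionmxK Pmon) char_poly_det unitrMr ?unitrX.
Qed.

(** * Eigenvalues of the map sending [A] to [S *m A *m T] *)

Section Eigenmatrices.
Context {F : fieldType}.

(** Left multiplication preserves the relation, so every nonzero vector in the row space of [B] is
    an eigenvector of [T]. *)
Lemma root_char_poly_row m q (T : 'M[F]_q) (B : 'M_(m, q)) c :
  B != 0 -> B *m T = c *: B -> root (char_poly T) c.
Proof.
move=> /rowV0Pn[v /submxP[D ->] v0] BT; rewrite -eigenvalue_root_char.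
by apply/eigenvalueP; exists (D *m B); rewrite // -mulmxA BT -scalemxAr.
Qed.

Lemma root_char_poly_col p q (S : 'M[F]_p) (B : 'M_(p, q)) c :
  B != 0 -> S *m B = c *: B -> root (char_poly S) c.
Proof.
move=> B0 SB; rewrite -(_ : char_poly S^T = char_poly S).
  apply: (@root_char_poly_row q _ _ B^T); last by rewrite -trmx_mul SB linearZ.
  by rewrite -trmx0 (inj_eq trmx_inj).
rewrite /char_poly -det_tr; congr (\det _).
by apply/matrixP=> i j; rewrite !mxE eq_sym.
Qed.

(* The space [{B | S B T = z B}] is stable under right multiplication by [T], so
   it contains an eigenmatrix of the latter. *)
Lemma sandwich_eigenmatrix p q (S : 'M[F]_p) (T : 'M_q) (rs : seq F) z :
  char_poly T = \prod_(r <- rs) ('X - r%:P) ->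
  forall A : 'M_(p, q), A != 0 -> S *m A *m T = z *: A ->
  exists t (B : 'M_(p, q)), [/\ B != 0, S *m B *m T = z *: B & B *m T = t *: B].
Proof.
case: q T => [|q] T chT A A0; first by move: A0; rewrite thinmx0 eqxx.
(* By Cayley-Hamilton the product of the [T - r%:M] over all roots annihilates [A]. The factors are
   applied one at a time; the last nonzero matrix before the product vanishes is the eigenmatrix. *)
have := congr1 (fun M => A *m M) (Cayley_Hamilton T); rewrite chT mulmx0.
elim: rs A A0 {chT} => [|r rs IH] A A0 + SAT.
  by rewrite big_nil rmorph1 mulmx1 => /eqP; rewrite (negPf A0).
rewrite big_cons rmorphM rmorphB /= horner_mx_X horner_mx_C mulmxA.
have [/eqP+ _|B0] := eqVneq (A *m (T - r%:M)) 0;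
  last (move=> /(IH _ B0); apply).
  by rewrite mulmxBr subr_eq0 mul_mx_scalar => /eqP AT; exists r, A.
(* This commutation shows that multiplying [A] by [T - r%:M] preserves the relation
   [S *m A *m T = z *: A]. *)
have TrC : (T - r%:M) *m T = T *m (T - r%:M).
  by rewrite mulmxBl mulmxBr scalar_mxC.
by rewrite scalemxAl -SAT -!mulmxA TrC.
Qed.

End Eigenmatrices.

(** For an eigenmatrix [B] that also satisfies [B *m T = t *: B], the relation becomes
    [S *m B = (z / t) *: B]; invertibility of [T] makes [t] nonzero. *)
Lemma root_char_poly_sandwich (F : closedFieldType) p q
    (S : 'M[F]_p) (T : 'M_q) (A : 'M_(p, q)) z :
  T \in unitmx -> A != 0 -> S *m A *m T = z *: A ->
  exists s t, [/\ root (char_poly S) s, root (char_poly T) t & z = s * t].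
Proof.
move=> Tu A0 SAT; have [rs] := closed_field_poly_normal (char_poly T).
rewrite (monicP (char_poly_monic T)) scale1r => chT.
have [t [B [B0 SBT BT]]] := sandwich_eigenmatrix chT A0 SAT.
have t0 : t != 0.
  by apply: contraNneq B0 => t0; rewrite -(mulmxK Tu B) BT t0 scale0r mul0mx.
exists (z / t), t; split; last by rewrite divfK.
- apply: (root_char_poly_col B0); apply: (scalerI t0).
  by rewrite scalerA mulrC divfK // -SBT -mulmxA BT -scalemxAr.
- exact: root_char_poly_row B0 BT.
Qed.

(** * Bilinearity and skew-symmetry of the bracket *)

Section LieBracketTheory.
Context {K : fieldType} {L : lieAlgType K}.
Implicit Types x y : L.

HB.instance Definition _ x :=
  GRing.isLinear.Build K L L _ (lie_bracket x) (lie_bracketPr x).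

Lemma lie_bracketDl x y z :
  lie_bracket (x + y) z = lie_bracket x z + lie_bracket y z.
Proof. by have := lie_bracketPl z 1 x y; rewrite !scale1r. Qed.

Lemma lie_bracketDr x y z :
  lie_bracket z (x + y) = lie_bracket z x + lie_bracket z y.
Proof. by have := lie_bracketPr z 1 x y; rewrite !scale1r. Qed.

Lemma lie_bracket0l x : lie_bracket 0 x = 0.
Proof. by apply: (addrI (lie_bracket 0 x)); rewrite -lie_bracketDl !addr0. Qed.

Lemma lie_bracket0r x : lie_bracket x 0 = 0.
Proof. by apply: (addrI (lie_bracket x 0)); rewrite -lie_bracketDr !addr0. Qed.

Lemma lie_bracketZl a x y : lie_bracket (a *: x) y = a *: lie_bracket x y.
Proof. by have := lie_bracketPl y a x 0; rewrite lie_bracket0l !addr0. Qed.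

Lemma lie_bracketZr a x y : lie_bracket y (a *: x) = a *: lie_bracket y x.
Proof. by have := lie_bracketPr y a x 0; rewrite lie_bracket0r !addr0. Qed.

Lemma lie_bracketC x y : lie_bracket x y = - lie_bracket y x.
Proof.
apply/eqP; rewrite -addr_eq0; apply/eqP; have := lie_bracketxx (x + y).
by rewrite lie_bracketDl !lie_bracketDr !lie_bracketxx addr0 add0r.
Qed.

Lemma lie_bracket_lincomb (I J : finType) (a : I -> K) (b : J -> K) F G :
  lie_bracket (\sum_i a i *: F i : L) (\sum_j b j *: G j) =
  \sum_i \sum_j (a i * b j) *: lie_bracket (F i) (G j).
Proof.
rewrite (big_morph (lie_bracket^~ _) (fun _ _ => lie_bracketDl _ _ _)
  (lie_bracket0l _)); apply: eq_bigr => i _.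
rewrite (big_morph (lie_bracket _) (fun _ _ => lie_bracketDr _ _ _)
  (lie_bracket0r _)); apply: eq_bigr => j _.
by rewrite lie_bracketZl lie_bracketZr scalerA.
Qed.

Lemma lie_bracket_lincomb0 (I J : finType) (a : I -> K) (b : J -> K) F G :
  (forall i j, lie_bracket (F i) (G j) = 0) ->
  lie_bracket (\sum_i a i *: F i : L) (\sum_j b j *: G j) = 0.
Proof.
move=> FG0; rewrite lie_bracket_lincomb big1 // => i _.
by rewrite big1 // => j _; rewrite FG0 scaler0.
Qed.

End LieBracketTheory.

(** * The isomorphism with the matrix model, and the lower central series *)

Section StandardIsomorphism.
Context {K : fieldType} {L : lieAlgType K} {p q : nat}.
Variables (X : 'I_p -> 'I_q -> L) (Y : 'I_p -> L) (Z : 'I_q -> L).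
Hypothesis XYZ : standard_basis X Y Z.
Local Notation N := (standard_carrier K p q).

Definition basis_seq : seq L :=
  [seq X i j | i <- enum 'I_p, j <- enum 'I_q]
    ++ [seq Y i | i <- enum 'I_p] ++ [seq Z j | j <- enum 'I_q].

(** The [X] part is a single sum over pairs of indices, so that [lie_bracket_lincomb] applies to all
    three parts alike. *)
Definition of_standard (x : N) : L :=
  \sum_(k : 'I_p * 'I_q) x.1 k.1 k.2 *: X k.1 k.2
    + (\sum_i x.2.1 0 i *: Y i + \sum_j x.2.2 0 j *: Z j).

Lemma of_standard_linear : linear of_standard.
Proof.
move=> a x y; rewrite /of_standard !scalerDr addrACA; congr (_ + _).
  rewrite scaler_sumr -big_split; apply: eq_bigr => k _ /=.
  by rewrite !mxE scalerDl scalerA.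
rewrite addrACA; congr (_ + _); rewrite scaler_sumr -big_split;
  by apply: eq_bigr => k _ /=; rewrite !mxE scalerDl scalerA.
Qed.
HB.instance Definition _ := GRing.isLinear.Build K N L _ of_standard
  of_standard_linear.

Lemma of_standardX i j : of_standard (delta_mx i j, 0) = X i j.
Proof.
rewrite /of_standard /= (bigD1 (i, j)) //= mxE !eqxx scale1r !big1 ?addr0 //.
- by move=> k _; rewrite mxE scale0r.
- by move=> k _; rewrite mxE scale0r.
- by move=> [k l] kl; rewrite mxE -xpair_eqE (negPf kl) scale0r.
Qed.

Lemma of_standardY i : of_standard (0, (delta_mx 0 i, 0)) = Y i.
Proof.
rewrite /of_standard /= big1 => [|k _]; last by rewrite mxE scale0r.
rewrite [X in _ + (_ + X)]big1 => [|k _]; last by rewrite mxE scale0r.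
rewrite (bigD1 i) //= mxE !eqxx scale1r big1 ?add0r ?addr0 // => k /negPf ki.
by rewrite mxE ki scale0r.
Qed.

Lemma of_standardZ j : of_standard (0, (0, delta_mx 0 j)) = Z j.
Proof.
rewrite /of_standard /= big1 => [|k _]; last by rewrite mxE scale0r.
rewrite [X in _ + (X + _)]big1 => [|k _]; last by rewrite mxE scale0r.
rewrite (bigD1 j) //= mxE !eqxx scale1r big1 ?add0r ?addr0 // => k /negPf ki.
by rewrite mxE ki scale0r.
Qed.

Lemma mem_basis_seq v : v \in basis_seq ->
  [\/ exists i j, v = X i j, exists i, v = Y i | exists j, v = Z j].
Proof.
rewrite !mem_cat => /or3P[/allpairsP[[i j] [_ _ ->]]|/mapP[i _ ->]|/mapP[j _ ->]].
- by constructor 1; exists i, j.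
- by constructor 2; exists i.
- by constructor 3; exists j.
Qed.

Lemma free_basis_seq : free basis_seq.
Proof. exact: basis_free (standard_basisP XYZ). Qed.

Lemma span_basis_seq : <<basis_seq>>%VS = fullv.
Proof. by have /andP[/eqP] := standard_basisP XYZ. Qed.

Lemma size_basis_seq : size basis_seq = \dim {:L}.
Proof.
by rewrite -span_basis_seq; apply/eqP; rewrite eq_sym; exact: free_basis_seq.
Qed.

Lemma dim_standard : \dim {:L} = (p * q + p + q)%N.
Proof.
rewrite -size_basis_seq !size_cat size_allpairs !size_map -!enumT !size_enum_ord.
by rewrite addnA.
Qed.

Lemma of_standard_surj v : exists u, of_standard u = v.
Proof.
have : v \in (limg (linfun of_standard)).
  have /subvP : (fullv <= limg (linfun of_standard))%VS.
    rewrite -span_basis_seq; apply/span_subvP => w.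
    case/mem_basis_seq => [[i [j ->]]|[i ->]|[j ->]].
    - by rewrite -of_standardX -lfunE memv_img ?memvf.
    - by rewrite -of_standardY -lfunE memv_img ?memvf.
    - by rewrite -of_standardZ -lfunE memv_img ?memvf.
  by apply; exact: memvf.
by case/memv_imgP => u _ ->; exists u; rewrite lfunE.
Qed.

(** A surjective linear map between spaces of equal dimension has trivial kernel. *)
Lemma of_standard_inj : injective of_standard.
Proof.
suff : lker (linfun of_standard) == 0%VS.
  by move=> /lker0P inj x y xy; apply: inj; rewrite !lfunE.
have := limg_ker_dim (linfun of_standard) fullv; rewrite capfv -dimv_eq0.
have -> : limg (linfun of_standard) = fullv.
  apply/eqP; rewrite eqEsubv subvf; apply/subvP => v _.
  by have [u <-] := of_standard_surj v; rewrite -lfunE memv_img ?memvf.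
(* The dimension of the model unfolds by conversion into those of its three matrix factors. *)
rewrite dim_standard dimvf -[X in _ = X]/(p * q + (1 * p + 1 * q))%N !mul1n.
rewrite -(addnA (p * q)%N).
by move/(canRL (addnK _)); rewrite subnn => ->.
Qed.

(** By bilinearity, only the brackets between an [X] part and a [Y] part survive. *)
Lemma of_standard_bracket x y :
  of_standard (lie_bracket x y) = lie_bracket (of_standard x) (of_standard y).
Proof.
(* Only the terms with [i = k.1] are nonzero; for a fixed [j] their coefficients add up to an entry
   of the row [B] times the matrix [A]. *)
have bXY (A : 'M_(p, q)) (B : 'rV_p) : lie_bracket
    (\sum_(k : 'I_p * 'I_q) A k.1 k.2 *: X k.1 k.2) (\sum_i B 0 i *: Y i)
    = \sum_j (B *m A : 'rV_q) 0 j *: Z j.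
  rewrite lie_bracket_lincomb.
  transitivity (\sum_(k : 'I_p * 'I_q) (A k.1 k.2 * B 0 k.1) *: Z k.2).
    apply: eq_bigr => k _; rewrite (bigD1 k.1) //= (bracketXY XYZ) eqxx.
    rewrite big1 ?addr0 // => i /negPf ik.
    by rewrite (bracketXY XYZ) eq_sym ik scaler0.
  rewrite -(pair_bigA _ (fun i j => (A i j * B 0 i) *: Z j)) exchange_big /=.
  apply: eq_bigr => j _; rewrite mxE scaler_suml.
  by apply: eq_bigr => i _; rewrite mulrC.
have ZX0 j (k : 'I_p * 'I_q) : lie_bracket (Z j) (X k.1 k.2) = 0.
  by rewrite lie_bracketC (bracketXZ XYZ) oppr0.
have ZY0 j i : lie_bracket (Z j) (Y i) = 0.
  by rewrite lie_bracketC (bracketYZ XYZ) oppr0.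
rewrite [in RHS]/of_standard !lie_bracketDl !lie_bracketDr.
rewrite (lie_bracket_lincomb0 _ _ (fun _ _ => bracketXX XYZ _ _ _ _)).
rewrite (lie_bracket_lincomb0 _ _ (fun _ _ => bracketXZ XYZ _ _ _)).
rewrite (lie_bracket_lincomb0 _ _ (fun _ _ => bracketYY XYZ _ _)).
rewrite (lie_bracket_lincomb0 _ _ (fun _ _ => bracketYZ XYZ _ _)).
rewrite (lie_bracket_lincomb0 _ _ (fun _ _ => bracketZZ XYZ _ _)).
rewrite (lie_bracket_lincomb0 _ _ ZX0) (lie_bracket_lincomb0 _ _ ZY0).
(* The [Y] part of [x] against the [X] part of [y] comes in the reverse order of [bXY]; swapping it
   gives the minus sign of [standard_bracket]. *)
rewrite [X in _ = _ + (X + _ + _)]lie_bracketC !bXY !addr0 !add0r.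
rewrite /of_standard /= big1 ?add0r => [|k _]; last by rewrite mxE scale0r.
rewrite big1 ?add0r => [|k _]; last by rewrite mxE scale0r.
by rewrite -sumrB; apply: eq_bigr => j _; rewrite !mxE scalerBl.
Qed.

(** In the model a bracket has only a [Z] component. Conversely, [0 < p] supplies an index [i] such
    that each [Z j] is the bracket of [X i j] and [Y i]. *)
Lemma lower_central_standard1 : (0 < p)%N ->
  lower_central L 1 = <<[seq Z j | j <- enum 'I_q]>>%VS.
Proof.
move=> p0; apply/eqP; rewrite eqEsubv; apply/andP; split.
  apply/lie_bracketvP => u v _ _.
  have [[x <-] [y <-]] := (of_standard_surj u, of_standard_surj v).
  rewrite -of_standard_bracket /of_standard /= big1 => [|k _]; last first.
    by rewrite mxE scale0r.
  rewrite add0r big1 => [|i _]; last by rewrite mxE scale0r.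
  rewrite add0r memv_suml // => j _.
  by apply/memvZ/memv_span/map_f; rewrite mem_enum.
apply/span_subvP => _ /mapP[j _ ->].
have /lie_bracketvP := subvv (lower_central L 1).
move=> /(_ (X (Ordinal p0) j) (Y (Ordinal p0)) (memvf _) (memvf _)).
by rewrite (bracketXY XYZ) eqxx.
Qed.

Lemma dim_lower_central_standard1 : (0 < p)%N -> \dim (lower_central L 1) = q.
Proof.
move=> p0; have := free_basis_seq.
rewrite /basis_seq catA cat_free => /and3P[_ fZ _].
by rewrite lower_central_standard1 // (eqP fZ) size_map size_enum_ord.
Qed.

Lemma lower_central_standard2 : lower_central L 2 = 0%VS.
Proof.
apply/eqP; rewrite -subv0; apply/lie_bracketvP => u v _ vC.
(* The kernel of [lie_bracket u] is a subspace, so it is enough that it contains all brackets; these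
   have zero [X] and [Y] components. *)
suff /subvP/(_ v vC) : (lower_central L 1 <= lker (linfun (lie_bracket u)))%VS.
  by rewrite memv_ker lfunE memv0.
apply/lie_bracketvP => a b _ _; rewrite memv_ker lfunE /=.
have [[x <-] [y <-]] := (of_standard_surj u, of_standard_surj a).
have [z <-] := of_standard_surj b; rewrite -!of_standard_bracket.
rewrite -(linear0 of_standard); apply/eqP; congr of_standard.
by rewrite /lie_bracket /= /standard_bracket /= mulmx0 mul0mx subrr.
Qed.

(** The step is exactly two because [0 < q] makes the derived algebra, of dimension [q], nonzero. *)
Lemma has_type_standard : (0 < p)%N -> (0 < q)%N ->
  has_type L [:: p * q + p; q]%N.
Proof.
move=> p0 q0; split.
  split; first exact: lower_central_standard2.
  by apply/eqP; rewrite -dimv_eq0 dim_lower_central_standard1 // -lt0n.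
case=> [|[|//]] _; rewrite [nth _ _ _]/=.
  by rewrite (dim_lower_central_standard1 p0) dim_standard addnK.
by rewrite (dim_lower_central_standard1 p0) lower_central_standard2 dimv0 subn0.
Qed.

End StandardIsomorphism.

(** * Integrality of the matrix of an endomorphism in a basis *)

Section IntegralMatrices.
Context {R : realType} {L : lieAlgType R} (e : (\dim {:L}).-tuple L).
Hypothesis e_basis : basis_of {:L} e.

Lemma coord_basis_int v k : v \in e -> coord e k v \is a Num.int.
Proof.
by move=> /tnthP[i ->]; rewrite (tnth_nth 0) coord_free ?(basis_free e_basis).
Qed.

Lemma mxof_int (t : 'End(L)) :
    (forall v k, v \in e -> coord e k (t v) \is a Num.int) ->
  mxof e e t = map_mx intr (map_mx Num.floor (mxof e e t)).
Proof.
move=> t_int; apply/matrixP => i k; rewrite [RHS]mxE [in RHS]mxE floorK //.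
by rewrite !mxE /= vecof_delta t_int // mem_nth // size_tuple.
Qed.

(** The matrices of [t] and [t'] are integral and have product 1 over [R]; injectivity of the
    integers into [R] carries this identity back to the integers. *)
Lemma matrix_in_GLZ_inv (t t' : 'End(L)) : cancel t t' ->
    (forall v k, v \in e -> coord e k (t v) \is a Num.int) ->
    (forall v k, v \in e -> coord e k (t' v) \is a Num.int) ->
  matrix_in_GLZ e t.
Proof.
move=> tK t_int t'_int; set M := map_mx Num.floor (mxof e e t).
exists M; last exact: mxof_int.
apply: (proj1 (mulmx1_unit (_ : M *m map_mx Num.floor (mxof e e t') = _))).
suff /matrixP MM' : map_mx intr (M *m map_mx Num.floor (mxof e e t'))
    = map_mx intr 1%:M :> 'M[R]_(\dim {:L}).
  apply/matrixP => i j; apply: (@intr_inj R).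
  by have := MM' i j; rewrite ![LHS]mxE [RHS]mxE.
(* As [mxof] acts on rows, this order of factors represents [t'] after [t]. *)
rewrite map_mxM -!mxof_int // -mxof_comp // map_mx1.
rewrite (_ : (t' \o t)%VF = \1%VF) ?mxof1 ?(basis_free e_basis) //.
by apply/lfunP => v; rewrite comp_lfunE lfunE tK.
Qed.

End IntegralMatrices.

(** * Complex matrices as pairs of real ones *)

Section Complexification.
Context {R : rcfType}.
Local Notation cpx := (map_mx (real_complex R)).
Implicit Types z : R[i].

Definition complexify m n (A B : 'M[R]_(m, n)) : 'M[R[i]]_(m, n) :=
  cpx A + 'i%C *: cpx B.

Lemma complexify_eq0 m n (A B : 'M_(m, n)) :
  complexify A B = 0 -> A = 0 /\ B = 0.
Proof.
move=> AB0; split; apply/matrixP => i j; have /matrixP/(_ i j) := AB0;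
  by rewrite !mxE; simpc => -[].
Qed.

Lemma complexify_mull l m n (S : 'M_(l, m)) (A B : 'M_(m, n)) :
  cpx S *m complexify A B = complexify (S *m A) (S *m B).
Proof. by rewrite mulmxDr -scalemxAr -!map_mxM. Qed.

Lemma complexify_mulr l m n (T : 'M_(n, l)) (A B : 'M_(m, n)) :
  complexify A B *m cpx T = complexify (A *m T) (B *m T).
Proof. by rewrite mulmxDl -scalemxAl -!map_mxM. Qed.

Lemma complexifyZ m n z (A B : 'M_(m, n)) :
  z *: complexify A B =
  complexify (complex.Re z *: A - complex.Im z *: B)
    (complex.Im z *: A + complex.Re z *: B).
Proof.
case: z => a b; apply/matrixP => i j; apply/eqP; rewrite !mxE; simpc.
by rewrite /= (addrC (a * B i j)).
Qed.

Lemma complexify_ReIm m n (A : 'M[R[i]]_(m, n)) :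
  A = complexify (map_mx (@complex.Re R) A) (map_mx (@complex.Im R) A).
Proof. by apply/matrixP => i j; rewrite !mxE -complexE. Qed.

Lemma complexify_inj m n (A B A' B' : 'M_(m, n)) :
  complexify A B = complexify A' B' -> A = A' /\ B = B'.
Proof.
move=> /eqP; rewrite -subr_eq0 /complexify opprD addrACA -scalerBr -!map_mxB.
by move=> /eqP/complexify_eq0[/eqP+ /eqP]; rewrite !subr_eq0 => /eqP-> /eqP->.
Qed.

End Complexification.

(** These are the real and imaginary parts of the equation of a complex eigenvector. Stated with
    vectors of [L], they no longer involve the canonical basis and can be transported to the matrix
    model. *)
Lemma eigenvalue_realification (R : realType) (L : lieAlgType R) (t : 'End(L))
    (z : R[i]) :
  eigenvalue (map_mx (real_complex R)
    (mxof (vbasis {:L}) (vbasis {:L}) t)) z ->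
  exists x y : L, [/\ (x, y) <> (0, 0),
    t x = complex.Re z *: x - complex.Im z *: y &
    t y = complex.Im z *: x + complex.Re z *: y].
Proof.
have vB := vbasisP {:L}; set M := mxof _ _ t.
move=> /eigenvalueP[v + v0]; rewrite (complexify_ReIm v).
set a := map_mx _ v; set b := map_mx _ v.
rewrite complexify_mulr complexifyZ => /complexify_inj[aM bM].
exists (vecof (vbasis {:L}) a), (vecof (vbasis {:L}) b).
rewrite !(hom_vecof _ vB) -/M aM bM !linearB !linearD !linearZ /=.
split => //.
move=> [/eqP + /eqP]; rewrite !vecof_eq0 // => /eqP a0 /eqP b0.
move: v0; rewrite (complexify_ReIm v) -/a -/b a0 b0 /complexify map_mx0.
by rewrite scaler0 addr0 eqxx.
Qed.

(** * Automorphisms of the matrix model *)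

Section StandardAutomorphism.
Context {K : fieldType} {p q : nat}.
Local Notation N := (standard_carrier K p q).
Implicit Types (S Si : 'M[K]_p) (T : 'M[K]_q).

(** [Si] stands for the inverse of [S]. With [Si] as a separate argument the map is linear for all
    matrices, and its inverse is obtained by swapping [S] and [Si]. *)
Definition standard_aut S Si T (x : N) : N :=
  (S *m x.1 *m T, (x.2.1 *m Si, x.2.2 *m T)).

Lemma standard_aut_linear S Si T : linear (standard_aut S Si T).
Proof.
move=> a x y; rewrite /standard_aut /= !mulmxDl mulmxDr mulmxDl.
by rewrite -!scalemxAr -!scalemxAl.
Qed.
HB.instance Definition _ S Si T := GRing.isLinear.Build K N N _
  (standard_aut S Si T) (standard_aut_linear S Si T).

(** In [(y *m Si) *m (S *m A *m T)] the inner factors cancel, leaving [y *m A *m T]. *)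
Lemma standard_aut_bracket S Si T x y : Si *m S = 1%:M ->
  standard_aut S Si T (lie_bracket x y) =
  lie_bracket (standard_aut S Si T x) (standard_aut S Si T y).
Proof.
move=> SiS; rewrite /lie_bracket /= /standard_bracket /standard_aut /=.
rewrite mulmx0 !mul0mx; congr (_, (_, _)).
by rewrite mulmxBl -!mulmxA !(mulmxA Si S) SiS !mul1mx.
Qed.

Lemma standard_autK S Si T T' : Si *m S = 1%:M -> T *m T' = 1%:M ->
  cancel (standard_aut S Si T) (standard_aut Si S T').
Proof.
move=> SiS TT' [A [y z]]; rewrite /standard_aut /=.
by rewrite -!mulmxA TT' mulmxA SiS !mulmx1 mul1mx.
Qed.

End StandardAutomorphism.

(** * The Anosov property from a pair of integer matrices *)

Section StandardAnosov.
Context {R : realType} {L : lieAlgType R} {p q : nat}.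
Variables (X : 'I_p -> 'I_q -> L) (Y : 'I_p -> L) (Z : 'I_q -> L).
Hypothesis XYZ : standard_basis X Y Z.
Local Notation N := (standard_carrier R p q).
Local Notation psi := (of_standard X Y Z).

(** The witness is [g] conjugated by [psi], which is injective. *)
Lemma lift_standard (g : {linear N -> N}) :
  exists t : 'End(L), forall u, t (psi u) = psi (g u).
Proof.
pose f := linfun psi; exists (f \o linfun g \o f^-1)%VF => u.
have kf : lker f == 0%VS.
  by apply/lker0P => x y; rewrite !lfunE; exact: of_standard_inj.
rewrite !comp_lfunE -[psi u]lfunE -/f lker0_lfunK //.
by rewrite [linfun g u]lfunE [f _]lfunE.
Qed.

(** These are the points of the standard lattice: [psi] sends them to the integer combinations of
    the basis. *)
Definition integral_triple (x : N) :=
  [/\ forall i j, x.1 i j \is a Num.int, forall i, x.2.1 0 i \is a Num.int &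
      forall j, x.2.2 0 j \is a Num.int].

Lemma mulmx_int l m n (A : 'M[R]_(l, m)) (B : 'M_(m, n)) :
    (forall i j, A i j \is a Num.int) -> (forall i j, B i j \is a Num.int) ->
  forall i j, (A *m B) i j \is a Num.int.
Proof.
by move=> Aint Bint i j; rewrite mxE rpred_sum // => k _; rewrite rpredM.
Qed.

Lemma integral_triple_aut (S Si : 'M_p) (T : 'M_q) x :
    (forall i j, S i j \is a Num.int) -> (forall i j, Si i j \is a Num.int) ->
    (forall i j, T i j \is a Num.int) ->
  integral_triple x -> integral_triple (standard_aut S Si T x).
Proof.
move=> Sint Siint Tint [Xint Yint Zint]; split => /=.
- by do 2!apply: mulmx_int => //.
- by apply: mulmx_int => // i; rewrite ord1.
- by apply: mulmx_int => // i; rewrite ord1.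
Qed.

Lemma integral_triple_bracket x y :
  integral_triple x -> integral_triple y -> integral_triple (lie_bracket x y).
Proof.
move=> [Xint Yint Zint] [X'int Y'int Z'int]; split => [i j|i|j]; [by rewrite mxE..|].
rewrite -[_ 0 j]/((y.2.1 *m x.1 - x.2.1 *m y.1) 0 j) mxE [X in _ + X]mxE.
by rewrite rpredB // mulmx_int // => k l; rewrite ord1.
Qed.

Lemma delta_mx_int m n i j k l : (delta_mx i j : 'M[R]_(m, n)) k l \is a Num.int.
Proof. by rewrite mxE. Qed.

Lemma basis_seq_integral v : v \in basis_seq X Y Z ->
  exists2 x, integral_triple x & v = psi x.
Proof.
move=> /mem_basis_seq[[i [j ->]]|[i ->]|[j ->]].
- exists (delta_mx i j, 0); last by rewrite of_standardX.
  by split => *; rewrite ?delta_mx_int ?mxE.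
- exists (0, (delta_mx 0 i, 0)); last by rewrite of_standardY.
  by split => *; rewrite ?delta_mx_int ?mxE.
- exists (0, (0, delta_mx 0 j)); last by rewrite of_standardZ.
  by split => *; rewrite ?delta_mx_int ?mxE.
Qed.

Definition standard_tuple : (\dim {:L}).-tuple L :=
  Tuple (introT eqP (size_basis_seq XYZ)).
Local Notation e := standard_tuple.

Lemma standard_tuple_basis : basis_of {:L} e.
Proof. exact: standard_basisP XYZ. Qed.

Lemma coord_integral x k : integral_triple x -> coord e k (psi x) \is a Num.int.
Proof.
have eI v : v \in basis_seq X Y Z -> coord e k v \is a Num.int.
  exact: (coord_basis_int standard_tuple_basis).
move=> [Xint Yint Zint]; rewrite /of_standard !linearD !linear_sum /=.
rewrite !rpredD ?rpred_sum // => [[i j]|i|j] _; rewrite linearZ rpredM //= eI //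
  !mem_cat.
- by apply/orP; left; apply/allpairsP; exists (i, j); rewrite !mem_enum.
- by rewrite [in X in _ || X]map_f ?mem_enum ?orbT.
- by rewrite [in X in _ || (_ || X)]map_f ?mem_enum ?orbT.
Qed.

(** An eigenvector has a nonzero component in one of the three blocks of the model. There the
    eigenvalue is a product [s * t], the inverse of a root [s], or a root [t]. *)
Lemma Anosov_standard (S : 'M[int]_p) (T : 'M[int]_q) :
    S \in unitmx -> T \in unitmx ->
    (forall s : R[i], root (char_poly (map_mx intr S)) s -> `|s| != 1) ->
    (forall t : R[i], root (char_poly (map_mx intr T)) t -> `|t| != 1) ->
    (forall s t : R[i], root (char_poly (map_mx intr S)) s ->
       root (char_poly (map_mx intr T)) t -> `|s * t| != 1) ->
  Anosov L.
Proof.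
move=> Su Tu Snorm Tnorm STnorm.
pose r m (A : 'M[int]_m) : 'M[R]_m := map_mx intr A.
have rint m (A : 'M_m) i j : r m A i j \is a Num.int by rewrite mxE intr_int.
have rmul m (A B : 'M_m) : A *m B = 1%:M -> r m A *m r m B = 1%:M.
  by move=> AB; rewrite /r -map_mxM AB map_mx1.
have [SV VS] := (rmul _ _ _ (mulmxV Su), rmul _ _ _ (mulVmx Su)).
have [TV VT] := (rmul _ _ _ (mulmxV Tu), rmul _ _ _ (mulVmx Tu)).
pose g := standard_aut (r _ S) (r _ (invmx S)) (r _ T).
pose g' := standard_aut (r _ (invmx S)) (r _ S) (r _ (invmx T)).
have [t tE] := lift_standard g; have [t' t'E] := lift_standard g'.
have tK : cancel t t'.
  move=> v; have [u <-] := of_standard_surj XYZ v.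
  by rewrite tE t'E; congr of_standard; exact: standard_autK.
have t'K : cancel t' t.
  move=> v; have [u <-] := of_standard_surj XYZ v.
  by rewrite t'E tE; congr of_standard; exact: standard_autK.
exists t; split.
- split; first by exists t'.
  move=> x y; have [u <-] := of_standard_surj XYZ x.
  have [w <-] := of_standard_surj XYZ y.
  rewrite !tE -!of_standard_bracket // tE; congr of_standard.
  exact: standard_aut_bracket.
- move=> z /eigenvalue_realification[x [y []]].
  have [u <-] := of_standard_surj XYZ x; have [w <-] := of_standard_surj XYZ y.
  rewrite !tE -!linearZ -linearB -linearD => uw0.
  move=> /(of_standard_inj XYZ) gu /(of_standard_inj XYZ) gw.
  have toC m (A : 'M[int]_m) : map_mx (real_complex R) (r m A) = map_mx intr A.
    by apply/matrixP => i j; rewrite !mxE rmorph_int.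
  (* The pair [u], [w] gives the real and imaginary parts of one complex triple; [e1], [e2] and [e3]
     are its eigenvalue equations block by block. *)
  have e1 : map_mx intr S *m complexify u.1 w.1 *m map_mx intr T
      = z *: complexify u.1 w.1.
    rewrite -!toC complexify_mull complexify_mulr complexifyZ.
    congr complexify; [exact: (congr1 (fun x : N => x.1) gu) |
      exact: (congr1 (fun x : N => x.1) gw)].
  have e2 : complexify u.2.1 w.2.1 *m map_mx intr (invmx S)
      = z *: complexify u.2.1 w.2.1.
    rewrite -!toC complexify_mulr complexifyZ.
    congr complexify; [exact: (congr1 (fun x : N => x.2.1) gu) |
      exact: (congr1 (fun x : N => x.2.1) gw)].
  have e3 : complexify u.2.2 w.2.2 *m map_mx intr T
      = z *: complexify u.2.2 w.2.2.
    rewrite -!toC complexify_mulr complexifyZ.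
    congr complexify; [exact: (congr1 (fun x : N => x.2.2) gu) |
      exact: (congr1 (fun x : N => x.2.2) gw)].
  have [/complexify_eq0[u1 w1]|A0] := eqVneq (complexify u.1 w.1) 0;
    last first.
    have TuC : map_mx intr T \in @unitmx R[i] q.
      by rewrite -toC map_unitmx; have [] := mulmx1_unit TV.
    have [s [s' [rs rs' ->]]] := root_char_poly_sandwich TuC A0 e1.
    exact: STnorm.
  have [/complexify_eq0[u2 w2]|A0] := eqVneq (complexify u.2.1 w.2.1) 0;
    last first.
    (* Right multiplication of [e2] by [S] removes the inverse; it shows that [z] is nonzero and
       that [z^-1] is an eigenvalue of [S]. *)
    have e2' : complexify u.2.1 w.2.1
        = z *: (complexify u.2.1 w.2.1 *m map_mx intr S).
      by rewrite scalemxAl -e2 -mulmxA -!toC -map_mxM VS map_mx1 mulmx1.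
    have z0 : z != 0 by apply: contraNneq A0 => z0; rewrite e2' z0 scale0r.
    have /Snorm : root (char_poly (map_mx intr S)) z^-1.
      apply: (root_char_poly_row A0); apply: (scalerI z0).
      by rewrite -e2' scalerA divff // scale1r.
    by rewrite normfV invr_eq1.
  have [/complexify_eq0[u3 w3]|A0] := eqVneq (complexify u.2.2 w.2.2) 0;
    last first.
    exact: Tnorm (root_char_poly_row A0 e3).
  (* All three blocks vanish, so both vectors are zero, against the choice of an eigenvector. *)
  case: uw0; case: u u1 u2 u3 {gu gw e1 e2 e3 tE} => [? [? ?]] /= -> -> ->.
  case: w w1 w2 w3 => [? [? ?]] /= -> -> ->.
  by rewrite -[(0, (0, 0))]/(0 : N) linear0.
- exists e.
    split=> [|i j k]; first exact: standard_tuple_basis.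
    have /basis_seq_integral[x xint ->] : e`_i \in basis_seq X Y Z.
      by rewrite (mem_nth 0) // size_basis_seq.
    have /basis_seq_integral[y yint ->] : e`_j \in basis_seq X Y Z.
      by rewrite (mem_nth 0) // size_basis_seq.
    rewrite -of_standard_bracket // coord_integral //.
    exact: integral_triple_bracket.
  (* Both [t] and its inverse [t'] preserve the standard lattice, since [S], [T] and their inverses
     are integral. *)
  apply: (matrix_in_GLZ_inv standard_tuple_basis tK) => v k.
  + move=> /basis_seq_integral[x xint ->].
    by rewrite tE coord_integral //; apply: integral_triple_aut.
  + move=> /basis_seq_integral[x xint ->].
    by rewrite t'E coord_integral //; apply: integral_triple_aut.
Qed.

End StandardAnosov.

(** * Conjugates of a unit as eigenvalues of an integer matrix *)

(** The characteristic polynomial of [S] is the minimal polynomial of [x], so its complex roots are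
    conjugates of [x]. *)
Lemma conjugate_unit_matrix (R : realType) (d : nat) (x : R[i])
    (s : 'I_d -> R[i]) :
    has_degree x d -> conjugates x s -> algebraic_integer_unit x ->
  (0 < d)%N /\ exists2 S : 'M[int]_d, S \in unitmx &
    forall y : R[i], root (char_poly (map_mx intr S)) y -> exists i, s i = y.
Proof.
move=> [P Pmin sP] [_ sconj] xu.
have [P1 [P1mon PE P10]] := minimal_poly_unit Pmin xu.
(* An irreducible polynomial is not constant, whence a positive degree. *)
split; first by have [_ [+ _] _] := Pmin; rewrite sP.
have sP1 : size P1 = d.+1 by rewrite -sP PE size_rat_int_poly.
have [S Su chS] := unit_char_poly_matrix P1mon sP1 P10.
exists S => // y; rewrite -map_char_poly chS -map_poly_ratr_intr -PE => Py.
by apply/sconj; exists P.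
Qed.

Theorem mainTheorem2 (R : realType) (p q : nat) (lambda mu : R[i])
  (lambda_ : 'I_p -> R[i]) (mu_ : 'I_q -> R[i])
  (lambda_deg : has_degree lambda p) (mu_deg : has_degree mu q)
  (lambda_conj : conjugates lambda lambda_) (mu_conj : conjugates mu mu_)
  (lambda_unit : algebraic_integer_unit lambda)
  (mu_unit : algebraic_integer_unit mu)
  (lambda_norm : forall i, `|lambda_ i| != 1)
  (mu_norm : forall j, `|mu_ j| != 1)
  (lambda_mu_norm : forall i j, `|lambda_ i * mu_ j| != 1)
  (n : lieAlgType R)
  (X : 'I_p -> 'I_q -> n) (Y : 'I_p -> n) (Z : 'I_q -> n)
  (n_basis : standard_basis X Y Z) :
  [/\ nilpotent_of_step n 2, Anosov n & has_type n [:: p * q + p; q]%N].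
Proof.
have [p0 [S Su rootS]] :=
  conjugate_unit_matrix lambda_deg lambda_conj lambda_unit.
have [q0 [T Tu rootT]] := conjugate_unit_matrix mu_deg mu_conj mu_unit.
have typen := has_type_standard n_basis p0 q0.
split; [exact: typen.1 | | exact: typen].
apply: (Anosov_standard n_basis Su Tu) => [s|t|s t].
- by move=> /rootS[i <-].
- by move=> /rootT[j <-].
- by move=> /rootS[i <-] /rootT[j <-].
Qed.
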